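(* For all $n\ge 0$ and $0\le k\le n$, $s_n^k(321)=|SR_n(k)|$.
   Context: $s_n^k(321)$ is the number of permutations $\pi=\pi_1\cdots\pi_n$ of $\{1,\dots,n\}$ avoiding $321$ (no indices $i<j<l$ with $\pi_i>\pi_j>\pi_l$) with exactly $k$ fixed points (indices $i$ with $\pi_i=i$). The set of similarity relations on $\{1,\dots,n\}$ is encoded as the set of integer sequences $SR_n=\{r_1r_2\cdots r_n: r_1=0,\ 0\le r_{i+1}\le r_i+1 \text{ for } 1\le i\le n-1\}$ ($SR_0$ consists of the empty sequence). An index $i$ is an isolated point of $r\in SR_n$ if $r_i=0$ and either $i=n$ or $r_{i+1}=0$. $SR_n(k)$ is the set of $r\in SR_n$ with exactly $k$ isolated points. *)

(* Defs.v *)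
From mathcomp Require Import all_boot all_fingroup.

Set Implicit Arguments.
Unset Strict Implicit.
Unset Printing Implicit Defensive.

(* Positions and values are numbered from 0: {1, ..., n} is 'I_n via i |-> i - 1. *)

Definition avoids321 n (s : 'S_n) : bool :=
  ~~ [exists i : 'I_n, exists j : 'I_n, exists l : 'I_n,
       [&& i < j, j < l, s j < s i & s l < s j]].

Definition fixed_points n (s : 'S_n) : {set 'I_n} := [set i | s i == i].

Definition s321 (n k : nat) : nat :=
  #|[set s : 'S_n | avoids321 s && (#|fixed_points s| == k)]|.

(* r_1 = 0 and r_(i+1) <= r_i + 1; the first clause holds for the empty r. *)
Definition is_similarity (r : seq nat) : bool :=
  (nth 0 r 0 == 0) && sorted (fun a b => b <= a.+1) r.

(* The index i is meant to satisfy i < size r. *)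
Definition isolated (r : seq nat) (i : nat) : bool :=
  (nth 0 r i == 0) && ((i.+1 == size r) || (nth 0 r i.+1 == 0)).

(* Typing the entries in 'I_n only makes the ambient type finite: it excludes
   no sequence, as shown by SRP below. *)
Definition SR (n : nat) : {set n.-tuple 'I_n} :=
  [set r : n.-tuple 'I_n | is_similarity (map val r)].

Definition isolated_points n (r : n.-tuple 'I_n) : {set 'I_n} :=
  [set i : 'I_n | isolated (map val r) i].

Definition SRk (n k : nat) : {set n.-tuple 'I_n} :=
  [set r in SR n | #|isolated_points r| == k].

Lemma similarity_nth r i : is_similarity r -> i < size r -> nth 0 r i <= i.
Proof.
case/andP=> /eqP r0 /(sortedP 0) rS; elim: i => [|i IHi] lt_i; first by rewrite r0.
by apply: leq_trans (rS _ lt_i) _; rewrite ltnS IHi // ltnW.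
Qed.

Lemma SRP n (r : seq nat) :
  (exists2 t : n.-tuple 'I_n, t \in SR n & map val t = r) <->
  size r = n /\ is_similarity r.
Proof.
split=> [[t] | [<- rP]].
  by rewrite inE => tP <-; rewrite size_map size_tuple.
have lt_r (i : 'I_(size r)) : nth 0 r i < size r.
  by apply: leq_ltn_trans (ltn_ord i); apply: similarity_nth.
pose t := [tuple Ordinal (lt_r i) | i < size r].
have tE : map val t = r.
  rewrite /= -map_comp -[RHS](mkseq_nth 0) /mkseq -val_enum_ord -map_comp.
  exact: eq_map.
by exists t; rewrite // inE tE.
Qed.

(* Main.v *)
(* A 321-avoiding permutation s is determined by its running maxima
   M i = max (s 0, ..., s i): the records carry the values M i, and the other
   positions receive the remaining values in increasing order. The sequences M
   that occur are the weakly increasing ones with i <= M i < n, so reading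
   M i - i from right to left gives exactly the similarity relations. Avoiding
   321 forces s i = i to split s into two blocks around i, so i is fixed iff
   M i = i and (i = 0 or M (i-1) = i-1), which is isolation in the relation. *)

Require Import Defs.
From mathcomp Require Import all_boot all_fingroup.
From mathcomp Require Import zify.

Set Implicit Arguments.
Unset Strict Implicit.
Unset Printing Implicit Defensive.

Lemma avoids321P n (s : 'S_n) :
  reflect (forall i j l : 'I_n, i < j -> j < l -> s j < s i -> s l < s j -> False)
          (avoids321 s).
Proof.
apply: (iffP idP) => [/existsPn av i j l ij jl ji lj | av].
  move: (av i) => /existsPn/(_ j)/existsPn/(_ l).
  by rewrite ij jl ji lj.
apply/existsPn => i; apply/existsPn => j; apply/existsPn => l.
by apply/negP => /and4P[]; apply: av.
Qed.

(** * Running maxima and fixed points *)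

Definition running_max n (s : 'S_n) (i : nat) : nat :=
  \max_(j : 'I_n | j <= i) s j.

Section RunningMax.
Variables (n : nat) (s : 'S_n).
Implicit Types i j : 'I_n.

Lemma le_running_max i (m : nat) : i <= m -> s i <= running_max s m.
Proof. by move=> le_im; rewrite /running_max (bigD1 i) //= leq_maxl. Qed.

Lemma running_max_le (m b : nat) :
  (forall i, i <= m -> s i <= b) -> running_max s m <= b.
Proof. by move=> le_b; apply/bigmax_leqP. Qed.

Lemma running_max_attained i (m : nat) :
  i <= m -> exists2 j : 'I_n, j <= m & running_max s m = s j.
Proof.
move=> le_im; have [|j jm jE] := @eq_bigmax_cond _ (fun j : 'I_n => j <= m) (fun j => s j).
  by apply/card_gt0P; exists i.
by exists j.
Qed.

Lemma running_max_lt i : running_max s i < n.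
Proof. by have [j _ ->] := running_max_attained (leqnn i). Qed.

Lemma running_maxS (m : nat) : running_max s m <= running_max s m.+1.
Proof. by apply: running_max_le => i /leqW; apply: le_running_max. Qed.

(** Pigeonhole: otherwise the [i + 1] positions up to [i] would inject into the [i] values below
    [i]. *)
Lemma running_max_ge i : i <= running_max s i.
Proof.
rewrite leqNgt; apply/negP => lt_i.
have sub : s @: [set j : 'I_n | j <= i] \subset [set j : 'I_n | j < i].
  apply/subsetP => _ /imsetP[j + ->]; rewrite !inE => /le_running_max.
  by move/leq_ltn_trans; apply.
have := subset_leq_card sub; rewrite card_imset; last exact: perm_inj.
have -> : [set j : 'I_n | j <= i] = i |: [set j : 'I_n | j < i].
  by apply/setP => j; rewrite !inE leq_eqVlt.
by rewrite cardsU1 inE ltnn /= add1n ltnn.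
Qed.

Lemma running_max_record i :
  (forall j, j < i -> s j < s i) -> running_max s i = s i.
Proof.
move=> rec; apply/eqP; rewrite eqn_leq le_running_max // andbT.
apply: running_max_le => j; rewrite leq_eqVlt.
by case/predU1P => [/val_inj -> // | /rec/ltnW].
Qed.

(** If [s j > i], no [l > i] has [s l < i], since [j, i, l] would form a 321 pattern. So [s] maps
    the positions from [i] on into themselves, hence onto by finiteness, which leaves no room for
    the value [s j]. *)
Lemma avoids321_fixed_left i j : avoids321 s -> s i = i -> j < i -> s j < i.
Proof.
move=> /avoids321P av si ji; rewrite ltnNge; apply/negP => le_i.
have lt_i : i < s j.
  rewrite ltn_neqAle le_i andbT -[X in nat_of_ord X != _]si val_eqE.
  by rewrite (inj_eq perm_inj) -val_eqE gtn_eqF.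
pose A := [set l : 'I_n | i <= l].
have sub : s @: A \subset A.
  apply/subsetP => _ /imsetP[l + ->]; rewrite !inE leq_eqVlt.
  case/predU1P => [/val_inj <-|il]; first by rewrite si.
  by rewrite leqNgt; apply/negP => li; apply: (av j i l); rewrite ?si.
have /eqP AE : s @: A == A.
  by rewrite eqEcard sub (card_imset _ perm_inj) /=.
have : s j \in s @: A by rewrite AE inE ltnW.
by rewrite (mem_imset _ _ perm_inj) inE leqNgt ji.
Qed.

Lemma fixed_running_max i : avoids321 s ->
  (s i == i) = (running_max s i == i)
               && ((i == 0 :> nat) || (running_max s i.-1 == i.-1)).
Proof.
move=> av; apply/eqP/andP => [si | [/eqP Mi i1]].
  have lt_i := avoids321_fixed_left av si.
  split.
    rewrite eqn_leq running_max_ge andbT; apply: running_max_le => j.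
    by rewrite leq_eqVlt => /predU1P[/val_inj -> | /lt_i/ltnW //]; rewrite si.
  case: posnP => //= i_gt0.
  have lt_in : i.-1 < n by apply: leq_ltn_trans (leq_pred i) _.
  rewrite eqn_leq (running_max_ge (Ordinal lt_in)) andbT.
  by apply: running_max_le => j; rewrite -ltnS prednK // => /lt_i; lia.
(* A maximum [i] attained at some [j < i] would already force the running maximum at [i - 1] to be
   at least [i]. *)
have [j le_ji Mj] := running_max_attained (leqnn i).
suff ji : j = i by apply: val_inj; rewrite /= -Mi Mj ji.
apply: val_inj; apply/eqP; move: le_ji; rewrite leq_eqVlt => /orP[// | lt_ji].
have := @le_running_max j i.-1; rewrite -Mj Mi.
by case/orP: i1 => /eqP; lia.
Qed.

End RunningMax.

(* At the first position where two such permutations differ, the larger of the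
   two values is not a record, so it is the middle of a 321 pattern. *)
Lemma running_max_inj n (s t : 'S_n) : avoids321 s -> avoids321 t ->
  (forall i : 'I_n, running_max s i = running_max t i) -> s = t.
Proof.
move=> avs avt eqM; apply/permP.
suff H m : forall i : 'I_n, i < m -> s i = t i by move=> i; apply: (H i.+1).
elim: m => [//|m IHm] i; rewrite ltnS leq_eqVlt => /predU1P[im | /IHm //].
(* Stated for [u] and [v] so as to serve both orders of [s i] and [t i]. *)
have step (u v : 'S_n) : avoids321 v ->
    (forall j : 'I_n, running_max u j = running_max v j) ->
    (forall j : 'I_n, j < m -> u j = v j) -> u i < v i -> False.
  move=> /avoids321P av eM eq_lt lt_uv.
  have [j vj] : exists j, v j = u i by exists (v^-1%g (u i)); rewrite permKV.
  have ij : i < j.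
    rewrite ltnNge leq_eqVlt; apply/negP => /predU1P[/val_inj ji | ji].
      by move: lt_uv; rewrite -vj ji ltnn.
    have uj : u j = u i by rewrite -vj eq_lt // -im.
    by move: ji; rewrite (perm_inj uj) ltnn.
  (* In [v] the value [u i] sits at [j > i], so a larger value before [v i] makes [l, i, j] a 321
     pattern. *)
  have [/existsP[l /andP[li vl]] | /existsPn rec] :=
      boolP [exists l : 'I_n, (l < i) && (v i < v l)].
    by apply: (av l i j) => //; rewrite vj.
  have {}rec (l : 'I_n) : l < i -> v l < v i.
    move=> li; have := rec l; rewrite li -leqNgt leq_eqVlt.
    by case/predU1P => // /val_inj/perm_inj ll; rewrite ll ltnn in li.
  have Mv := running_max_record rec.
  (* Now [v i] is a record, so [u] must reach the value [v i] at some [l <= i]; both [l = i] and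
     [l < i] are impossible. *)
  have [l le_li Ml] := running_max_attained u (leqnn i).
  have ul : u l = v i by apply: val_inj; rewrite /= -Ml eM.
  move: le_li; rewrite leq_eqVlt => /predU1P[/val_inj li | li].
    by move: lt_uv; rewrite -ul li ltnn.
  have vl : v l = v i by rewrite -ul eq_lt // -im.
  by move: li; rewrite (perm_inj vl) ltnn.
apply: val_inj; case: (ltngtP (s i) (t i)) => // [/(step s t avt eqM IHm) // |].
by case/(step t s avs) => [j | j /IHm]; rewrite ?eqM.
Qed.

(** * Construction of a 321-avoiding permutation with prescribed running maxima *)

Section Inverse.
Variables (n : nat) (M : nat -> nat).
Hypothesis M_bounds : forall i, i < n -> i <= M i < n.
Hypothesis M_step : forall i, i.+1 < n -> M i <= M i.+1.

Let record (i : nat) := (i == 0) || (M i.-1 < M i).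
Let values := [seq M i | i <- iota 0 n].
(** The bound [m] is a parameter so that the gaps up to [M i] can be singled out as a prefix of
    [gaps n]. *)
Let gaps (m : nat) := [seq v <- iota 0 m | v \notin values].
Let nonrecords_before (i : nat) := count (predC record) (iota 0 i).

(* Records take the value [M i]; the other positions receive the values missed
   by [M] in increasing order. *)
Let inverse (i : nat) : nat :=
  if record i then M i else nth 0 (gaps n) (nonrecords_before i).

Let M_mono i j : i <= j -> j < n -> M i <= M j.
Proof.
elim: j => [|j IHj]; first by rewrite leqn0 => /eqP ->.
rewrite leq_eqVlt => /predU1P[-> // | ij] jn.
by apply: leq_trans (IHj _ (ltnW jn)) (M_step jn).
Qed.

Let M_record_lt i j : i < j -> j < n -> record j -> M i < M j.
Proof.
move=> ij jn /orP[/eqP j0 | ]; first by rewrite j0 in ij.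
by apply: leq_ltn_trans; apply: M_mono; lia.
Qed.

Let last_record i : i < n -> exists2 j, j <= i & record j && (M j == M i).
Proof.
elim: i => [|i IHi] i_n; first by exists 0 => //=; rewrite eqxx.
have [rec | nrec] := boolP (record i.+1); first by exists i.+1; rewrite ?rec ?eqxx.
have [j ji /andP[rj /eqP Mj]] := IHi (ltnW i_n).
exists j; first exact: leqW.
rewrite rj Mj eqn_leq M_step //=.
by move: nrec; rewrite /record /= -leqNgt.
Qed.

(** Each value of [M] is taken at a record, and a record after [i] has a value above [M i]. *)
Let count_values i : i < n ->
  count (fun v => v \in values) (iota 0 (M i).+1) <= count record (iota 0 i.+1).
Proof.
move=> i_n; rewrite -!size_filter -(size_map M [seq j <- _ | record j]).
apply: uniq_leq_size => [|v]; first by rewrite filter_uniq ?iota_uniq.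
rewrite mem_filter mem_iota add0n ltnS => /andP[/mapP[m + ->] /andP[_ Mmi]].
rewrite mem_iota add0n => /andP[_ mn].
have [j jm /andP[rj /eqP Mj]] := last_record mn.
rewrite -Mj; apply/mapP; exists j => //.
rewrite mem_filter rj mem_iota /= add0n ltnS leqNgt; apply/negP => ij.
by have := M_record_lt ij (leq_ltn_trans jm mn) rj; rewrite Mj ltnNge Mmi.
Qed.

Let nonrecords_before_mono i j : i < j -> ~~ record i ->
  nonrecords_before i < nonrecords_before j.
Proof.
move=> ij nri; rewrite /nonrecords_before -(subnKC ij) iotaD count_cat -addn1.
by rewrite -[in X in _ <= X]addn1 iotaD count_cat /= nri addn0 leq_addr.
Qed.

(** Of the [M i + 1 >= i + 1] numbers up to [M i], at most as many are values of [M] as there are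
    records up to [i]. So the gaps are at least as many as the nonrecords up to [i], and [i] itself
    is one of these. *)
Let nonrecords_bound i : i < n -> ~~ record i ->
  nonrecords_before i < size (gaps (M i).+1).
Proof.
move=> i_n nri; have := count_values i_n.
have := count_predC (fun v => v \in values) (iota 0 (M i).+1).
have := count_predC record (iota 0 i.+1).
rewrite !size_iota size_filter.
have -> : count (predC record) (iota 0 i.+1) = (nonrecords_before i).+1.
  by rewrite -addn1 iotaD count_cat /= nri addn0 addn1.
have : i <= M i by case/andP: (M_bounds i_n).
rewrite (@eq_count _ (predC (fun v => v \in values)) (fun v => v \notin values)) //.
by lia.
Qed.

Let gapsD i : i < n -> gaps n = gaps (M i).+1 ++
  [seq v <- iota (M i).+1 (n - (M i).+1) | v \notin values].
Proof.
move=> /M_bounds/andP[_ Mn].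
by rewrite /gaps -{1}(subnKC Mn) iotaD filter_cat add0n.
Qed.

(** The index lies in the prefix [gaps (M i).+1] of [gaps n], so the default of [nth] is never
    reached. *)
Let inverse_gap i : i < n -> ~~ record i ->
  (inverse i <= M i) && (inverse i \notin values).
Proof.
move=> i_n nri; have lt_i := nonrecords_bound i_n nri.
rewrite /inverse (negbTE nri) (gapsD i_n) nth_cat lt_i.
have := mem_nth 0 lt_i; rewrite mem_filter mem_iota add0n ltnS.
by case/andP=> -> /andP[_ ->].
Qed.

Let inverse_le i : i < n -> inverse i <= M i.
Proof.
move=> i_n; have [ri | nri] := boolP (record i); first by rewrite /inverse ri.
by case/andP: (inverse_gap i_n nri).
Qed.

Let inverse_lt i : i < n -> inverse i < n.
Proof.
move=> i_n; apply: leq_ltn_trans (inverse_le i_n) _.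
by case/andP: (M_bounds i_n).
Qed.

Let inverse_nonrecord_mono i j : i < j -> j < n -> ~~ record i -> ~~ record j ->
  inverse i < inverse j.
Proof.
move=> ij jn nri nrj; rewrite /inverse (negbTE nri) (negbTE nrj).
have lt_size m : m < n -> ~~ record m -> nonrecords_before m < size (gaps n).
  move=> mn nrm; apply: leq_trans (nonrecords_bound mn nrm) _.
  by rewrite (gapsD mn) size_cat leq_addr.
apply: (sorted_ltn_nth ltn_trans); rewrite ?inE ?lt_size //.
- by rewrite sorted_filter ?iota_ltn_sorted //; apply: ltn_trans.
- exact: ltn_trans jn.
- exact: nonrecords_before_mono.
Qed.

Let inverse_record_mono i j : i < j -> j < n -> record j -> inverse i < inverse j.
Proof.
move=> ij jn rj; apply: leq_ltn_trans (inverse_le (ltn_trans ij jn)) _.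
by rewrite {1}/inverse rj M_record_lt.
Qed.

Let inverse_inj i j : i < j -> j < n -> inverse i != inverse j.
Proof.
move=> ij jn; have i_n := ltn_trans ij jn.
have [rj | nrj] := boolP (record j).
  by rewrite ltn_eqF // inverse_record_mono.
have [ri | nri] := boolP (record i); last first.
  by rewrite ltn_eqF // inverse_nonrecord_mono.
have /andP[_] := inverse_gap jn nrj; apply: contra => /eqP <-.
by rewrite /inverse ri map_f // mem_iota.
Qed.

Lemma running_max_surj :
  exists2 s : 'S_n, avoids321 s & forall i : 'I_n, running_max s i = M i.
Proof.
pose f (i : 'I_n) := Ordinal (inverse_lt (ltn_ord i)).
have f_inj : injective f.
  move=> i j /(congr1 val) /= eq_ij; apply: val_inj => /=.
  case: (ltngtP i j) => // lt_ij.
    by move: (inverse_inj lt_ij (ltn_ord j)); rewrite eq_ij eqxx.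
  by move: (inverse_inj lt_ij (ltn_ord i)); rewrite eq_ij eqxx.
have sE i : perm f_inj i = inverse i :> nat by rewrite permE.
exists (perm f_inj) => [|i].
  (* A record exceeds everything before it, so [j] and [l] would both be nonrecords, whose values
     increase. *)
  apply/avoids321P => i j l ij jl; rewrite !sE => ji lj.
  have [rj | nrj] := boolP (record j).
    by have := inverse_record_mono ij (ltn_ord j) rj; rewrite ltnNge ltnW.
  have [rl | nrl] := boolP (record l).
    by have := inverse_record_mono jl (ltn_ord l) rl; rewrite ltnNge ltnW.
  by have := inverse_nonrecord_mono jl (ltn_ord l) nrj nrl; rewrite ltnNge ltnW.
apply/eqP; rewrite eqn_leq; apply/andP; split.
  apply: running_max_le => j ji; rewrite sE.
  by apply: leq_trans (inverse_le (ltn_ord j)) (M_mono ji (ltn_ord i)).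
have [j ji /andP[rj /eqP <-]] := last_record (ltn_ord i).
have jn := leq_ltn_trans ji (ltn_ord i).
have := @le_running_max _ (perm f_inj) (Ordinal jn) _ ji.
by rewrite sE /= /inverse rj.
Qed.

End Inverse.

(** * The correspondence with similarity relations *)

Lemma running_max_offset_subproof n (s : 'S_n) (p : 'I_n) :
  running_max s (rev_ord p) - rev_ord p < n.
Proof. exact: leq_ltn_trans (leq_subr _ _) (running_max_lt s (rev_ord p)). Qed.

(** From [i] to [i + 1] the excess of the running maximum over the index drops by at most 1;
    [rev_ord] turns this into the growth condition. *)
Definition similarity_of_perm n (s : 'S_n) : n.-tuple 'I_n :=
  [tuple Ordinal (running_max_offset_subproof s p) | p < n].

Lemma nth_similarity_of_perm n (s : 'S_n) (p : nat) : p < n ->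
  nth 0 (map val (similarity_of_perm s)) p = running_max s (n - p.+1) - (n - p.+1).
Proof.
move=> pn.
by rewrite (nth_map (Ordinal pn)) ?size_tuple // -(tnth_nth _ _ (Ordinal pn)) tnth_mktuple.
Qed.

Lemma similarity_of_perm_SR n (s : 'S_n) : similarity_of_perm s \in SR n.
Proof.
rewrite inE; apply/andP; split.
  case: (posnP n) => [n0 | n_gt0].
    by rewrite nth_default // size_map size_tuple n0.
  rewrite nth_similarity_of_perm // subn_eq0.
  have lt_n : n - 1 < n by lia.
  by have := running_max_lt s (Ordinal lt_n); rewrite /=; lia.
apply/(sortedP 0) => p; rewrite size_map size_tuple => pn.
rewrite !nth_similarity_of_perm //; last exact: ltnW.
have := running_maxS s (n - p.+2).
have -> : (n - p.+2).+1 = n - p.+1 by lia.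
by lia.
Qed.

Lemma isolated_points_similarity_of_perm n (s : 'S_n) : avoids321 s ->
  isolated_points (similarity_of_perm s) = [set rev_ord i | i in fixed_points s].
Proof.
move=> av; apply/setP => p.
rewrite -{2}(rev_ordK p) mem_imset; last exact: rev_ord_inj.
rewrite !inE fixed_running_max // /isolated size_map size_tuple.
rewrite nth_similarity_of_perm //= subn_eq0; congr andb.
  by rewrite [RHS]eqn_leq (running_max_ge s (rev_ord p)) andbT.
have pn := ltn_ord p.
(* The last entry of the relation corresponds to position 0 of [s], and entry [p + 1] to the
   position before [rev_ord p]. *)
have -> : (n - p.+1 == 0) = (p.+1 == n) by lia.
case: eqP => //= /eqP pn'; have pn2 : p.+1 < n by lia.
rewrite nth_similarity_of_perm // subn_eq0.
rewrite -subnS [RHS]eqn_leq.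
by rewrite (running_max_ge s (rev_ord (Ordinal pn2))) andbT.
Qed.

Lemma similarity_of_perm_inj n :
  {in [pred s : 'S_n | avoids321 s] &, injective (@similarity_of_perm n)}.
Proof.
move=> s t avs avt eq_st; apply: running_max_inj => // i.
have := congr1 (fun r : n.-tuple 'I_n => nth 0 (map val r) (rev_ord i)) eq_st.
rewrite /= !nth_similarity_of_perm ?(ltn_ord (rev_ord i)) //=.
have -> : n - (n - i.+1).+1 = i by have := ltn_ord i; lia.
(* These bounds make the truncated subtractions exact, hence cancellable. *)
have := running_max_ge s i; have := running_max_ge t i.
by lia.
Qed.

Lemma similarity_of_perm_surj n (r : n.-tuple 'I_n) : r \in SR n ->
  exists2 s : 'S_n, avoids321 s & similarity_of_perm s = r.
Proof.
rewrite inE; set r' := map val r => rP.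
have sz : size r' = n by rewrite size_map size_tuple.
pose M i := nth 0 r' (n - i.+1) + i.
have M_bounds i : i < n -> i <= M i < n.
  move=> i_n; rewrite leq_addl /=.
  (* The entry at [p] is at most [p]; for [p = n - 1 - i] this gives [M i <= n - 1]. *)
  have lt_n : n - i.+1 < size r' by rewrite sz; lia.
  by have := similarity_nth rP lt_n; rewrite /M; lia.
have M_step i : i.+1 < n -> M i <= M i.+1.
  move=> i_n; case/andP: rP => _ /(sortedP 0)/(_ (n - i.+2)).
  rewrite sz /M; have -> : (n - i.+2).+1 = n - i.+1 by lia.
  have lt_n : n - i.+1 < n by lia.
  by move/(_ lt_n); lia.
have [s av sM] := running_max_surj M_bounds M_step.
exists s => //; apply: eq_from_tnth => p; rewrite tnth_mktuple.
apply: val_inj; rewrite /= (sM (rev_ord p)) /M /= addnK.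
have -> : n - (n - p.+1).+1 = p by have := ltn_ord p; lia.
by rewrite (nth_map p) ?size_tuple // -tnth_nth.
Qed.

Theorem theorem3p4 (n k : nat) (hk : k <= n) : s321 n k = #|SRk n k|.
Proof.
have isoE (s : 'S_n) : avoids321 s ->
    #|isolated_points (similarity_of_perm s)| = #|fixed_points s|.
  move=> av; rewrite isolated_points_similarity_of_perm // card_imset //.
  exact: rev_ord_inj.
rewrite /s321 -(card_in_imset (f := @similarity_of_perm n)); last first.
  move=> s t; rewrite !inE => /andP[avs _] /andP[avt _].
  exact: similarity_of_perm_inj.
congr #|pred_of_set _|; apply/setP => r; apply/imsetP/idP.
  case=> s; rewrite inE => /andP[av fixk] ->.
  by rewrite inE similarity_of_perm_SR isoE.
rewrite inE => /andP[/similarity_of_perm_surj[s av <-]]; rewrite isoE // => fixk.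
by exists s; rewrite // inE av.
Qed.
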